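(* Let $n\ge2$ and let arcs $(a,b)$ be drawn on $n$ points $1,\dots,n$ placed on a horizontal line. Call an arrangement of arcs allowed if it avoids the following patterns: (i) two disjoint arcs $(i,j)$ and $(k,l)$ with $1\le i<j<k<l\le n$; (ii) three arcs $(i,k),(j,l),(k,m)$ with $1\le i<j<k<l<m\le n$; (iii) three arcs $(i,l),(j,m),(k,s)$ with $1\le i<j<k<l<m<s\le n$. Then: (1) every non-maximal allowed arrangement extends to an allowed arrangement with $2n-3$ arcs; (2) the maximum number of arcs in an allowed arrangement is $2n-3$; (3) the number of maximal allowed arrangements equals the Catalan number $C_{n-2}$.
   Context: An arc is a pair $(a,b)$ of integers with $1\le a<b\le n$, and an arrangement is a set of (distinct) arcs. An allowed arrangement is maximal if it is not properly contained in another allowed arrangement. The Catalan number is $C_m=\frac1{m+1}\binom{2m}{m}$. *)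

(* Defs.v *)
From mathcomp Require Import all_boot.

Set Implicit Arguments.
Unset Strict Implicit.
Unset Printing Implicit Defensive.

(* The points 1, ..., n are the elements 0, ..., n-1 of 'I_n: arcs and patterns
   only depend on the order of the points. *)
Definition is_arc n (p : 'I_n * 'I_n) : bool := p.1 < p.2.

Definition arrangement n (A : {set 'I_n * 'I_n}) : bool :=
  [forall p in A, is_arc p].

Definition avoids_i n (A : {set 'I_n * 'I_n}) : bool :=
  [forall i : 'I_n, forall j : 'I_n, forall k : 'I_n, forall l : 'I_n,
    [&& i < j, j < k & k < l] ==>
    ~~ [&& (i, j) \in A & (k, l) \in A]].

Definition avoids_ii n (A : {set 'I_n * 'I_n}) : bool :=
  [forall i : 'I_n, forall j : 'I_n, forall k : 'I_n, forall l : 'I_n,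
   forall m : 'I_n,
    [&& i < j, j < k, k < l & l < m] ==>
    ~~ [&& (i, k) \in A, (j, l) \in A & (k, m) \in A]].

Definition avoids_iii n (A : {set 'I_n * 'I_n}) : bool :=
  [forall i : 'I_n, forall j : 'I_n, forall k : 'I_n, forall l : 'I_n,
   forall m : 'I_n, forall s : 'I_n,
    [&& i < j, j < k, k < l, l < m & m < s] ==>
    ~~ [&& (i, l) \in A, (j, m) \in A & (k, s) \in A]].

Definition allowed n (A : {set 'I_n * 'I_n}) : bool :=
  [&& arrangement A, avoids_i A, avoids_ii A & avoids_iii A].

Definition maximal_allowed n (A : {set 'I_n * 'I_n}) : bool :=
  maxset (@allowed n) A.

(* The division is exact. *)
Definition catalan (m : nat) : nat := 'C(m.*2, m) %/ m.+1.

(* Main.v *)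
Require Import Defs.
From mathcomp Require Import all_boot.
From mathcomp Require Import zify.

Set Implicit Arguments.
Unset Strict Implicit.
Unset Printing Implicit Defensive.

(** Write n = k + 2 and regard an arc (a, b) as the cell in row a and column b
    of a grid, ordered by strict increase of both coordinates. Avoiding (i)
    says that every left endpoint is at most every right endpoint; given this,
    avoiding (ii) and (iii) says that the arcs contain no chain of three cells
    ([allowedP]).

    Sets of cells without 3-chains are the sets covered by two antichains, and
    the inclusion-maximal antichains are lattice paths. Reading the arcs by
    decreasing length, a path meets every length once, and from one length to
    the next the left endpoint either stays or moves one point to the right.
    The two paths that matter both start at the longest arc, are disjoint
    afterwards, and for k > 0 end, at length 1, in two adjacent arcs (p - 1,
    p) and (p, p + 1). Such a pair has 1 + 2 k = 2 n - 3 arcs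
    ([card_path_arcs]), is allowed ([allowed_path_arcs]), and is determined by
    its set of arcs ([path_arcs_inj]). Conversely every allowed arrangement is
    contained in the union of such a pair ([allowed_sub_path_arcs]): apart
    from arcs on the border of the grid, one path goes through the arcs of the
    arrangement that are minimal for the grid order, the other through the
    remaining ones. As all these unions have the same size, they are exactly
    the maximal allowed arrangements, and any allowed arrangement extends to
    one of them.

    It remains to count the pairs when k > 0. After the first step, the gap
    between the two paths changes at each step by -1, by 0 in two ways, or by
    1; it stays positive and comes back to its initial value. These are the
    Motzkin paths of length k - 1 with two kinds of level steps, whose number
    is the Catalan number of k; this follows from the recurrence on the gap,
    solved by the reflection principle ([motzkin_number_bin]). *)

(** * Allowed arrangements as sets without chains *)

Definition below {n} (c c' : 'I_n * 'I_n) : bool := (c.1 < c'.1) && (c.2 < c'.2).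

(** In a chain of three arcs, avoiding (i) for the outer two leaves the cases
    where the first ends at the left endpoint of the third, which is (ii), or
    after it, which is (iii). *)
Lemma allowedP n (A : {set 'I_n * 'I_n}) :
  reflect [/\ forall c : 'I_n * 'I_n, c \in A -> c.1 < c.2,
              forall c c' : 'I_n * 'I_n, c \in A -> c' \in A -> c'.1 <= c.2
            & forall c1 c2 c3 : 'I_n * 'I_n, c1 \in A -> c2 \in A -> c3 \in A ->
                below c1 c2 -> ~~ below c2 c3]
          (allowed A).
Proof.
apply: (iffP and4P) => [[arcA Ai Aii Aiii]|[arcA meetA chainA]].
  have arc (c : 'I_n * 'I_n) : c \in A -> c.1 < c.2.
    by move=> cA; exact: (implyP (forallP arcA c)).
  have meet (c c' : 'I_n * 'I_n) : c \in A -> c' \in A -> c'.1 <= c.2.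
    case: c c' => [i j] [l m] cA c'A /=; rewrite leqNgt; apply/negP => lt_jl.
    move/forallP/(_ i)/forallP/(_ j)/forallP/(_ l)/forallP/(_ m)/implyP: Ai.
    by rewrite cA c'A lt_jl (arc _ cA : i < j) (arc _ c'A : l < m) => /(_ isT).
  split=> // -[i i'] [j j'] [l l'] c1 c2 c3; rewrite /below /=.
  move=> /andP[ij i'j']; apply/negP => /andP[jl j'l'].
  have := meet _ _ c1 c3; rewrite /= leq_eqVlt => /orP[/eqP/val_inj eq_li|lt_li].
    subst i'.
    move/forallP/(_ i)/forallP/(_ j)/forallP/(_ l)/forallP/(_ j')/forallP/(_ l'): Aii.
    by rewrite c1 c2 c3 ij jl i'j' j'l'.
  move/forallP/(_ i)/forallP/(_ j)/forallP/(_ l)/forallP/(_ i')/forallP/(_ j'): Aiii.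
  by move/forallP/(_ l'); rewrite c1 c2 c3 ij jl lt_li i'j' j'l'.
split.
- by apply/forallP => c; apply/implyP/arcA.
- apply/forallP => i; apply/forallP => j; apply/forallP => l; apply/forallP => m.
  apply/implyP => /and3P[_ jl _]; apply/negP => /andP[c1 c2].
  by have /= := meetA _ _ c1 c2; rewrite leqNgt jl.
- apply/forallP => i; apply/forallP => j; apply/forallP => l; apply/forallP => m.
  apply/forallP => s; apply/implyP => /and4P[ij jl lm ms].
  apply/negP => /and3P[c1 c2 c3]; have := chainA _ _ _ c1 c2 c3.
  by rewrite /below /= ij jl lm ms => /(_ isT).
- apply/forallP => i; apply/forallP => j; apply/forallP => l; apply/forallP => m.
  apply/forallP => s; apply/forallP => r; apply/implyP => /and5P[ij jl _ ms sr].
  apply/negP => /and3P[c1 c2 c3]; have := chainA _ _ _ c1 c2 c3.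
  by rewrite /below /= ij jl ms sr => /(_ isT).
Qed.

(** * Pairs of lattice paths *)

Section Steps.
Variables (T : Type) (p : pred T).
Implicit Types (v : seq T) (t : nat).

Definition steps v t : nat := count p (take t v).

Lemma steps0 v : steps v 0 = 0.
Proof. by rewrite /steps take0. Qed.

Lemma stepsS x0 v t : t < size v -> steps v t.+1 = steps v t + p (nth x0 v t).
Proof. by move=> ltv; rewrite /steps (take_nth x0) // -cats1 count_cat /= addn0. Qed.

Lemma leq_steps v t u : t <= u -> steps v t <= steps v u.
Proof.
move=> le_tu; rewrite /steps -(subnKC le_tu) takeD count_cat; exact: leq_addr.
Qed.

Lemma steps_leq v t u : t <= u -> steps v u <= steps v t + (u - t).
Proof.
move=> le_tu; rewrite /steps -{1}(subnKC le_tu) takeD count_cat leq_add2l.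
by apply: leq_trans (count_size _ _) _; rewrite size_take; case: ltnP.
Qed.

Lemma steps_le v t : steps v t <= t.
Proof. by have := steps_leq v (leq0n t); rewrite steps0 subn0. Qed.

End Steps.

(** A word codes a pair of paths: the two bits of its letter number t tell
    whether the left endpoints on the lower and on the upper path move right
    between the arcs of length k + 1 - t and those of length k - t.  Hence [lo]
    and [hi] are the left endpoints after t steps. *)
Definition lo (v : seq (bool * bool)) (t : nat) : nat := steps (fun x => x.1) v t.
Definition hi (v : seq (bool * bool)) (t : nat) : nat := steps (fun x => x.2) v t.

Lemma lo0 v : lo v 0 = 0.
Proof. exact: steps0. Qed.

Lemma hi0 v : hi v 0 = 0.
Proof. exact: steps0. Qed.

Lemma word_of_paths k (X Y : nat -> nat) :
  X 0 = 0 -> Y 0 = 0 ->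
  (forall t, t < k -> X t <= X t.+1 <= (X t).+1) ->
  (forall t, t < k -> Y t <= Y t.+1 <= (Y t).+1) ->
  exists v : k.-tuple (bool * bool),
    forall t, t <= k -> lo v t = X t /\ hi v t = Y t.
Proof.
move=> X0 Y0 stX stY.
pose x t := (X t < X t.+1, Y t < Y t.+1).
have sz : size (mkseq x k) == k by rewrite size_mkseq.
exists (Tuple sz) => /=; elim=> [|t IHt] lt_tk; first by rewrite !lo0 !hi0.
have [IHX IHY] := IHt (ltnW lt_tk).
rewrite /lo /hi !(stepsS _ (false, false)) ?size_mkseq // nth_mkseq //=.
rewrite -/(lo _ _) -/(hi _ _) IHX IHY.
by have := stX _ lt_tk; have := stY _ lt_tk; lia.
Qed.

Lemma lo_hi_inj (v w : seq (bool * bool)) :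
  size v = size w ->
  (forall t, t <= size v -> lo v t = lo w t /\ hi v t = hi w t) -> v = w.
Proof.
move=> szE eq_vw; apply: (eq_from_nth (x0 := (false, false))) => // t lt_t.
have [] := eq_vw _ lt_t; have [] := eq_vw _ (ltnW lt_t).
rewrite /lo /hi !(stepsS _ (false, false)) -?szE // => -> -> /addnI + /addnI.
by case: (nth _ v t) (nth _ w t) => [[] []] [[] []].
Qed.

(** The parameter h is the current gap, counted from its least admissible
    value. *)
Fixpoint motzkin (h : nat) (v : seq (bool * bool)) : bool :=
  if v is x :: w then (x.1 <= h + x.2) && motzkin (h + x.2 - x.1) w else h == 0.

(** The first letter separates the paths, which share the longest arc; this
    puts the gap at its least value, where it must be again at the end. *)
Definition valid (v : seq (bool * bool)) : bool :=
  if v is x :: w then (x == (false, true)) && motzkin 0 w else true.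

Lemma motzkinP h v :
  reflect ((forall t, t <= size v -> lo v t <= h + hi v t) /\
           lo v (size v) = h + hi v (size v))
          (motzkin h v).
Proof.
elim: v h => [|[a b] w IHw] h /=.
  apply: (iffP eqP) => [->|[_]]; last by rewrite /lo /hi /steps /= addn0.
  by split.
have loS t : lo ((a, b) :: w) t.+1 = a + lo w t by [].
have hiS t : hi ((a, b) :: w) t.+1 = b + hi w t by [].
apply: (iffP andP) => [[le_ab /IHw[le_w eq_w]]|[le_w]].
  rewrite loS hiS; split; last by lia.
  by case=> [|t] // /le_w; rewrite loS hiS; lia.
rewrite loS hiS => eq_w.
have le_ab := le_w 1 isT; rewrite loS hiS lo0 hi0 in le_ab.
split; first by lia.
apply/IHw; split; last by lia.
by move=> t /(le_w t.+1); rewrite loS hiS; lia.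
Qed.

(** The inequality at the end is an equality except for the empty word, where
    both paths are reduced to the longest arc. *)
Lemma validP v :
  reflect ((forall t, 0 < t <= size v -> lo v t < hi v t) /\
           hi v (size v) <= (lo v (size v)).+1)
          (valid v).
Proof.
case: v => [|[a b] w] /=; first by constructor; split=> // t; case: t.
have loS t : lo ((a, b) :: w) t.+1 = a + lo w t by [].
have hiS t : hi ((a, b) :: w) t.+1 = b + hi w t by [].
apply: (iffP andP) => [[/eqP[ea eb] /motzkinP[le_w eq_w]]|[lt_w]].
  subst a b; rewrite loS hiS; split; last by lia.
  by case=> [|t] // /le_w; rewrite loS hiS; lia.
rewrite loS hiS => eq_w.
have lt_ab := lt_w 1 isT; rewrite loS hiS lo0 hi0 in lt_ab.
have [ea eb] : a = false /\ b = true by case: a b lt_ab {loS hiS lt_w eq_w} => [] [].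
subst a b; split=> //; apply/motzkinP.
have le_w t : t <= size w -> lo w t <= 0 + hi w t.
  by move=> le_t; have := lt_w t.+1 le_t; rewrite loS hiS; lia.
by split=> //; have := le_w _ (leqnn _); lia.
Qed.

(** * The arrangement of a pair of paths *)

Section Arrangement.
Variable k : nat.
Implicit Types (v : seq (bool * bool)) (c : 'I_k.+2 * 'I_k.+2).

(** The number of steps that a path makes from the longest arc, of length k + 1,
    to an arc as long as c. *)
Definition depth c : nat := c.1 + (k.+1 - c.2).

Definition path_arcs v : {set 'I_k.+2 * 'I_k.+2} :=
  [set c : 'I_k.+2 * 'I_k.+2 | (c.1 < c.2) &&
           ((c.1 == lo v (depth c) :> nat) || (c.1 == hi v (depth c) :> nat))].

Lemma depthE c : c.2 + depth c = c.1 + k.+1.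
Proof. by rewrite /depth; have := ltn_ord c.2; lia. Qed.


Lemma arc_ext c c' : c.1 = c'.1 :> nat -> c.2 = c'.2 :> nat -> c = c'.
Proof. by case: c c' => a b [a' b'] /= /val_inj -> /val_inj ->. Qed.

(** Along a path the left endpoint weakly increases with the depth, while the
    right endpoint weakly decreases, since the length drops by 1 at each step. *)
Lemma steps_not_below (p : pred (bool * bool)) v c c' :
  c.1 = steps p v (depth c) :> nat -> c'.1 = steps p v (depth c') :> nat ->
  ~~ below c c'.
Proof.
move=> cE c'E; rewrite /below; have dc := depthE c; have dc' := depthE c'.
case: (leqP (depth c) (depth c')) => [le_d|/ltnW le_d].
  by have := steps_leq p v le_d; lia.
by have := leq_steps p v le_d; lia.
Qed.

(** Two of the three arcs of a chain would lie on the same path, which is an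
    antichain.  Left and right endpoints are separated by the last point [hi v k]:
    the final left endpoints are at most adjacent, and a path whose final arc is
    (a, a + 1) has all its right endpoints at or after a + 1. *)
Lemma allowed_path_arcs v : size v = k -> valid v -> allowed (path_arcs v).
Proof.
move=> szv /validP[]; rewrite szv => lt_v hi_end; apply/allowedP; split.
- by move=> c; rewrite inE => /andP[].
- move=> c c'; rewrite !inE => /andP[arc on] /andP[arc' on'].
  have dc := depthE c; have dc' := depthE c'.
  have [le_d le_d'] : depth c <= k /\ depth c' <= k by lia.
  have lo_hi : lo v k <= hi v k.
    case: (posnP k) => [->|k_gt0]; first by rewrite !lo0 !hi0.
    by rewrite ltnW // lt_v // k_gt0 /=.
  have lo_c' : lo v (depth c') <= lo v k by exact: leq_steps.
  have hi_c' : hi v (depth c') <= hi v k by exact: leq_steps.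
  have lo_c : lo v k <= lo v (depth c) + (k - depth c) by exact: steps_leq.
  have hi_c : hi v k <= hi v (depth c) + (k - depth c) by exact: steps_leq.
  by lia.
- move=> c1 c2 c3; rewrite !inE => /andP[_ on1] /andP[_ on2] /andP[_ on3] b12.
  apply/negP => b23.
  have b13 : below c1 c3 by move: b12 b23; rewrite /below; lia.
  by case/orP: on1 => /eqP on1; case/orP: on2 => /eqP on2;
    case/orP: on3 => /eqP on3;
    first [ by move: b12; apply/negP/(steps_not_below on1 on2)
          | by move: b13; apply/negP/(steps_not_below on1 on3)
          | by move: b23; apply/negP/(steps_not_below on2 on3)].
Qed.

Definition step_arc (f : nat -> nat) (t : nat) : 'I_k.+2 * 'I_k.+2 :=
  (inord (f t), inord (f t + k.+1 - t)).

Lemma step_arcE (f : nat -> nat) t :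
  t <= k -> f t <= t ->
  [/\ (step_arc f t).1 = f t :> nat, (step_arc f t).2 = f t + k.+1 - t :> nat
    & depth (step_arc f t) = t].
Proof.
move=> le_t le_ft; have [lt1 lt2] : f t < k.+2 /\ f t + k.+1 - t < k.+2 by lia.
by rewrite /depth /step_arc /= !inordK //; split; lia.
Qed.

(** Each path has one arc of each of the k + 1 lengths, and the two paths share
    the longest arc only. *)
Lemma card_path_arcs v : size v = k -> valid v -> #|path_arcs v| = (2 * k).+1.
Proof.
move=> szv /validP[]; rewrite szv => lt_v _.
pose S f := [set step_arc f t | t : 'I_k.+1].
have card_S f : (forall t, f t <= t) -> #|S f| = k.+1.
  move=> le_f; rewrite card_imset ?card_ord // => t u /= eq_tu; apply/val_inj => /=.
  have [] := step_arcE (ltn_ord t : t <= k) (le_f t).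
  have [] := step_arcE (ltn_ord u : u <= k) (le_f u).
  by rewrite eq_tu => _ _ -> _ _ ->.
have mem_S f (c : 'I_k.+2 * 'I_k.+2) : (forall t, f t <= t) ->
    (c \in S f) = (c.1 < c.2) && (c.1 == f (depth c) :> nat).
  move=> le_f; have dc := depthE c; apply/imsetP/andP.
    case=> t _ ->; have [-> -> ->] := step_arcE (ltn_ord t : t <= k) (le_f t).
    by split=> //; have := ltn_ord t; lia.
  case=> arc /eqP cE; have le_d : depth c < k.+1 by lia.
  exists (Ordinal le_d) => //.
  have [e1 e2 _] := step_arcE (le_d : depth c <= k) (le_f _).
  by apply: arc_ext; rewrite ?e1 ?e2; lia.
have le_lo t : lo v t <= t by exact: steps_le.
have le_hi t : hi v t <= t by exact: steps_le.
have -> : path_arcs v = S (lo v) :|: S (hi v).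
  by apply/setP => c; rewrite in_setU !mem_S // inE andb_orr.
have : #|S (lo v) :&: S (hi v)| = 1.
  apply/eqP/cards1P; exists (ord0, ord_max); apply/setP => c.
  rewrite in_setI !mem_S // inE; have dc := depthE c.
  apply/andP/eqP => [[/andP[arc /eqP e1] /andP[_ /eqP e2]]|->] /=.
    have le_d : depth c <= k by lia.
    have d0 : depth c = 0.
      case: (posnP (depth c)) => // d_gt0; have := lt_v (depth c).
      by rewrite d_gt0 le_d -e1 -e2 ltnn => /(_ isT).
    rewrite d0 lo0 in e1.
    by apply: arc_ext => /=; lia.
  by rewrite /depth /= subnn !lo0 !hi0.
have := cardsUI (S (lo v)) (S (hi v)); rewrite !card_S //.
by move=> + cI; rewrite cI addn1 => -[->]; lia.
Qed.

(** The arcs of a given length in [path_arcs v] are one on each path; the one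
    with the smaller left endpoint lies on the lower path. *)
Lemma path_arcs_inj v w :
  size v = k -> size w = k -> valid v -> valid w ->
  path_arcs v = path_arcs w -> v = w.
Proof.
move=> szv szw /validP[+ _] /validP[+ _]; rewrite szv szw => lt_v lt_w eq_vw.
apply: lo_hi_inj; rewrite szv // => t le_t.
have on_w f : f t <= t -> step_arc f t \in path_arcs v ->
    f t = lo w t \/ f t = hi w t.
  move=> le_f; rewrite eq_vw inE; have [-> -> ->] := step_arcE le_t le_f.
  by case/andP=> _ /orP[] /eqP; [left | right].
have on_v f : f t <= t -> step_arc f t \in path_arcs w ->
    f t = lo v t \/ f t = hi v t.
  move=> le_f; rewrite -eq_vw inE; have [-> -> ->] := step_arcE le_t le_f.
  by case/andP=> _ /orP[] /eqP; [left | right].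
have on_lo u : step_arc (lo u) t \in path_arcs u.
  have le_f : lo u t <= t by exact: steps_le.
  by rewrite inE; have [-> -> ->] := step_arcE le_t le_f; rewrite eqxx andbT; lia.
have on_hi u : step_arc (hi u) t \in path_arcs u.
  have le_f : hi u t <= t by exact: steps_le.
  by rewrite inE; have [-> -> ->] := step_arcE le_t le_f; rewrite eqxx orbT andbT; lia.
have := on_w (lo v) (steps_le _ _ _) (on_lo v).
have := on_w (hi v) (steps_le _ _ _) (on_hi v).
have := on_v (lo w) (steps_le _ _ _) (on_lo w).
have := on_v (hi w) (steps_le _ _ _) (on_hi w).
case: (posnP t) => [->|t_gt0]; first by rewrite !lo0 !hi0.
by have := lt_v t; have := lt_w t; rewrite t_gt0 le_t => /(_ isT) + /(_ isT); lia.
Qed.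

(** * Every allowed arrangement lies on a pair of paths *)

(** The boundary of an up-closed set B of cells, read along the diagonals
    b - a = d: the value f d is the last row of that diagonal whose cell is
    outside B, or 0 if there is none.  The Galois connection form makes upper and lower bounds on f
    immediate consequences of the closure of B. *)
Lemma staircase (B : nat -> nat -> bool) N :
  (forall a b a' b', a <= a' -> b <= b' -> B a b -> B a' b') ->
  (forall b, B N.+1 b) ->
  exists f : nat -> nat, forall d a, (f d <= a) = B a.+1 (a.+1 + d).
Proof.
move=> monoB topB; have exB d : exists a, B a.+1 (a.+1 + d) by exists N.
exists (fun d => ex_minn (exB d)) => d a; case: ex_minnP => m Bm min_m.
by apply/idP/idP => [le_ma|/min_m //]; apply: monoB Bm; lia.
Qed.

(** The cells strictly above some arc of A, together with a border, form an
    up-closed set B1, and those strictly above a 2-chain of A, with a smaller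
    border, an up-closed set B2; the two paths follow their boundaries.  The cell
    after an arc c of A on its diagonal lies in B1, so the first path passes
    through c unless c itself lies in B1.  In that case c is on the border or is
    the top of a 2-chain, so that the next cell lies in B2, while c does not since
    A has no 3-chain: the second path passes through c.  The paths are disjoint
    because a cell (a + 1, b + 1) in B2 forces (a, b) into B1. *)
Lemma allowed_sub_path_arcs (A : {set 'I_k.+2 * 'I_k.+2}) :
  allowed A ->
  exists v : k.-tuple (bool * bool), valid v /\ A \subset path_arcs v.
Proof.
case/allowedP => arcA meetA chainA.
(* All arcs start at or before p and end at or after p; the bounds on p make it
   an interior point whenever there is one. *)
pose left (c : 'I_k.+2 * 'I_k.+2) : nat := c.1.
have [p [p_gt0 p_le le_p p_ge]] : exists p,
    [/\ 0 < p, p <= maxn 1 k, forall c : 'I_k.+2 * 'I_k.+2, c \in A -> c.1 <= p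
      & forall c : 'I_k.+2 * 'I_k.+2, c \in A -> p <= c.2].
  exists (maxn 1 (\max_(c in A) left c)); split; first by lia.
  - have : \max_(c in A) left c <= k; last by lia.
    by apply/bigmax_leqP => c /arcA lt12; apply: leq_trans lt12 (ltn_ord c.2).
  - by move=> c cA; rewrite leq_max (leq_bigmax_cond (F := left)) ?orbT.
  - move=> c cA; have := arcA _ cA.
    have : \max_(c in A) left c <= c.2; last by lia.
    by apply/bigmax_leqP => c' c'A; exact: meetA.
(* The half-planes are the borders: they clip the second path to the rectangle
   of arcs that start at or before p and end at or after p, and the first path
   to that rectangle without its last row and column, which leaves room for the
   second. *)
pose B1 a b := [|| p <= a, k < b
  | [exists c : 'I_k.+2 * 'I_k.+2 in A, (c.1 < a) && (c.2 < b)]].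
pose B2 a b := [|| p < a, k.+1 < b
  | [exists c : 'I_k.+2 * 'I_k.+2 in A, exists c' : 'I_k.+2 * 'I_k.+2 in A,
      below c c' && ((c'.1 < a) && (c'.2 < b))]].
have monoB1 a b a' b' : a <= a' -> b <= b' -> B1 a b -> B1 a' b'.
  move=> le_a le_b /or3P[?|?|/exists_inP[c cA lt_c]].
  - by apply/orP; left; lia.
  - by apply/or3P/Or32; lia.
  - by apply/or3P/Or33/exists_inP; exists c => //; lia.
have monoB2 a b a' b' : a <= a' -> b <= b' -> B2 a b -> B2 a' b'.
  move=> le_a le_b /or3P[?|?|/exists_inP[c cA /exists_inP[c' c'A lt_c]]].
  - by apply/orP; left; lia.
  - by apply/or3P/Or32; lia.
  - apply/or3P/Or33/exists_inP; exists c => //; apply/exists_inP; exists c' => //.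
    by case/andP: lt_c => -> /=; lia.
have B21 a b : B2 a.+1 b.+1 -> B1 a b.
  case/or3P=> [lt_p|lt_b|].
  - by apply/or3P/Or31.
  - by apply/or3P/Or32.
  case/exists_inP=> c cA /exists_inP[c' c'A /andP[/andP[]]] *.
  by apply/or3P/Or33/exists_inP; exists c => //; lia.
have B1_in (c : 'I_k.+2 * 'I_k.+2) : c \in A -> B1 c.1.+1 c.2.+1.
  by move=> cA; apply/or3P/Or33/exists_inP; exists c; rewrite // !ltnSn.
have B2_in (c : 'I_k.+2 * 'I_k.+2) : c \in A -> B1 c.1 c.2 -> B2 c.1.+1 c.2.+1.
  move=> cA /or3P[le_pc|lt_kc|/exists_inP[c' c'A lt_c']].
  - by apply/or3P/Or31.
  - by apply/or3P/Or32; lia.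
  apply/or3P/Or33/exists_inP; exists c' => //; apply/exists_inP; exists c => //.
  by rewrite !ltnSn /below lt_c'.
have B2_out (c : 'I_k.+2 * 'I_k.+2) : c \in A -> ~~ B2 c.1 c.2.
  move=> cA; rewrite !negb_or -!leqNgt le_p //= -ltnS ltn_ord /=.
  apply/negP => /exists_inP[c1 c1A /exists_inP[c2 c2A /andP[lt12 lt2]]].
  by have := chainA _ _ _ c1A c2A cA lt12; rewrite /below lt2.
have [x xE] := staircase (N := p) monoB1 (fun b => introT or3P (Or31 _ _ (leqnSn p))).
have [y yE] := staircase (N := p) monoB2 (fun b => introT or3P (Or31 _ _ (ltnSn p))).
(* The diagonals are indexed by the length of the arcs, and the paths by the
   depth. *)
pose X t := x (k.+1 - t); pose Y t := y (k.+1 - t).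
have stX t : t < k -> X t <= X t.+1 <= (X t).+1.
  move=> lt_tk; rewrite /X -(subnSK (ltnW lt_tk : t < k.+1)); set d := k.+1 - t.+1.
  by rewrite !xE; apply/andP; split; [have := leqnn (x d) | have := leqnn (x d.+1)];
    rewrite xE; apply: monoB1; lia.
have stY t : t < k -> Y t <= Y t.+1 <= (Y t).+1.
  move=> lt_tk; rewrite /Y -(subnSK (ltnW lt_tk : t < k.+1)); set d := k.+1 - t.+1.
  by rewrite !yE; apply/andP; split; [have := leqnn (y d) | have := leqnn (y d.+1)];
    rewrite yE; apply: monoB2; lia.
have X0 : X 0 = 0.
  by apply/eqP; rewrite -leqn0 xE; apply/or3P/Or32; lia.
have Y0 : Y 0 = 0.
  by apply/eqP; rewrite -leqn0 yE; apply/or3P/Or32; lia.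
have [v vE] := word_of_paths X0 Y0 stX stY.
exists v; split.
  apply/validP; rewrite size_tuple; split.
    move=> t /andP[t_gt0 le_tk]; have [-> ->] := vE _ le_tk.
    have Y_gt0 : 0 < Y t.
      rewrite ltnNge yE; apply/negP => /or3P[|| /exists_inP[c cA /exists_inP[c' c'A]]].
      - lia.
      - lia.
      - by rewrite /below; lia.
    have : B1 (Y t) (Y t + (k.+1 - t)) by apply: B21; rewrite -addSn -yE.
    by rewrite -{1 2}(prednK Y_gt0) -xE -ltnS prednK.
  have [-> ->] := vE _ (leqnn k).
  have Yp : Y k <= p by rewrite yE; apply/or3P/Or31.
  have : p.-1 <= X k; last by lia.
  case: (ltnP (X k) p.-1) => // lt_Xp.
  have := leqnn (X k); rewrite {1}/X subSnn xE => /or3P[||/exists_inP[c cA]]; try lia.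
  by have := p_ge c cA; lia.
suff on_paths (c : 'I_k.+2 * 'I_k.+2) : c \in A -> c \in path_arcs v.
  by apply/subsetP.
move=> cA; have arc := arcA c cA; have dc := depthE c.
have le_dk : depth c <= k by lia.
have [vX vY] := vE _ le_dk; rewrite inE arc vX vY /=.
have c2E : c.2 = c.1 + (k.+1 - depth c) :> nat by lia.
have [B1c|nB1c] := boolP (B1 c.1 c.2); apply/orP; [right | left]; rewrite eqn_leq.
  rewrite yE addSn -c2E B2_in // andbT leqNgt.
  apply/negP => lt_Y; have : Y (depth c) <= c.1.-1 by lia.
  rewrite yE addSn => /(monoB2 _ _ c.1 c.2) B2c.
  by have := B2_out _ cA; rewrite B2c //; lia.
rewrite xE addSn -c2E B1_in // andbT leqNgt.
apply/negP => lt_X; have : X (depth c) <= c.1.-1 by lia.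
rewrite xE addSn => /(monoB1 _ _ c.1 c.2) B1c.
by move: nB1c; rewrite B1c //; lia.
Qed.
End Arrangement.

(** * Counting the pairs of paths *)

Lemma card_tuple_cons (T : finType) m (P : pred (seq T)) :
  #|[set w : m.+1.-tuple T | P w]| =
    \sum_(x : T) #|[set w : m.-tuple T | P (x :: w)]|.
Proof.
rewrite -sum1dep_card; under [RHS]eq_bigr do rewrite -sum1dep_card.
rewrite pair_big_dep /= (reindex (fun x : T * m.-tuple T => [tuple of x.1 :: x.2])) //=.
exists (fun w => (thead w, behead_tuple w)) => [[x w] _|w _] /=.
  by congr pair; apply/val_inj.
by rewrite [RHS](tuple_eta w).
Qed.

Definition motzkin_number m h : nat :=
  #|[set w : m.-tuple (bool * bool) | motzkin h w]|.

Lemma motzkin_number0 h : motzkin_number 0 h = (h == 0).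
Proof.
rewrite /motzkin_number; case: eqP => [->|/eqP nz_h]; last first.
  by apply: eq_card0 => w; rewrite inE tuple0 /= (negbTE nz_h).
rewrite (eq_card (B := predT)) ?card_tuple ?expn0 // => w.
by rewrite inE tuple0.
Qed.

Lemma motzkin_numberS m h :
  motzkin_number m.+1 h =
    motzkin_number m h.+1 + 2 * motzkin_number m h
    + (if h is h'.+1 then motzkin_number m h' else 0).
Proof.
rewrite /motzkin_number card_tuple_cons.
rewrite -(pair_bigA _ (fun a b =>
  #|[set w : m.-tuple (bool * bool) | motzkin h ((a, b) :: w)]|)) /= !big_bool /=.
rewrite !addn0 !subn0 !addn1 subn1 ltnS leq0n /=.
case: h => [|h] /=.
  by rewrite (eq_card0 (A := [set w | false])) ?subn0; [lia | move=> w; rewrite inE].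
rewrite subn1 /=; lia.
Qed.

(** Reflection principle: splitting each step into two half steps,
    'C(2 m + 1, m + h + 1) - 'C(2 m + 1, m + h + 2) solves the recurrence for all
    integers h, and it vanishes at h = - 1 by symmetry of the binomials, which is
    the boundary condition. *)
Lemma motzkin_number_bin m h :
  motzkin_number m h + 'C(2 * m + 1, m + h + 2) = 'C(2 * m + 1, m + h + 1).
Proof.
elim: m h => [|m IHm] h.
  rewrite motzkin_number0 muln0 !add0n addn2 addn1.
  by case: h => [|h]; rewrite // !bin_small.
have pascal2 j : 'C(2 * m.+1 + 1, j + 2) =
    'C(2 * m + 1, j + 2) + 2 * 'C(2 * m + 1, j + 1) + 'C(2 * m + 1, j).
  have -> : 2 * m.+1 + 1 = (2 * m + 1).+2 by lia.
  by rewrite addn2 (addn1 j) !binS; lia.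
have -> : m.+1 + h + 2 = (m + h + 1) + 2 by lia.
have -> : m.+1 + h + 1 = (m + h) + 2 by lia.
rewrite !pascal2 motzkin_numberS.
have := IHm h; have := IHm h.+1.
have -> : m + h.+1 + 2 = m + h + 1 + 2 by lia.
have -> : m + h.+1 + 1 = m + h + 2 by lia.
have -> : m + h + 1 + 1 = m + h + 2 by lia.
case: h => [|h].
  have : 'C(2 * m + 1, m + 0) = 'C(2 * m + 1, m + 0 + 1).
    by rewrite -bin_sub; [congr 'C(_, _); lia | lia].
  by lia.
have := IHm h.
have -> : m + h + 2 = m + h.+1 + 1 by lia.
have -> : m + h + 1 = m + h.+1 by lia.
by lia.
Qed.

Lemma motzkin_number_catalan m : motzkin_number m 0 = catalan m.+1.
Proof.
rewrite /catalan; have := motzkin_number_bin m 0; rewrite !addn0 !addn1 addn2 => numE.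
have binE := mul_bin_left (2 * m).+1 m.+1.
have -> : 'C(m.+1.*2, m.+1) = motzkin_number m 0 * m.+2; last by rewrite mulnK.
have -> : m.+1.*2 = (2 * m).+2 by lia.
rewrite binS.
have -> : 'C((2 * m).+1, m) = 'C((2 * m).+1, m.+1).
  by rewrite -bin_sub; [congr 'C(_, _); lia | lia].
rewrite -numE in binE *; move: binE; have -> : (2 * m).+1 - m.+1 = m by lia.
by nia.
Qed.

Lemma card_valid k : #|[set v : k.-tuple (bool * bool) | valid v]| = catalan k.
Proof.
case: k => [|m].
  rewrite (eq_card (B := predT)) ?card_tuple ?expn0 // => w.
  by rewrite inE tuple0.
(* Only the letter that separates the paths can come first. *)
rewrite card_tuple_cons (bigD1 (false, true)) //= big1 ?addn0.
  exact: motzkin_number_catalan.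
by move=> x /negbTE ->; apply: eq_card0 => w; rewrite inE.
Qed.

(** * Maximal arrangements *)

(** Every allowed arrangement is contained in the union of two paths, and these
    unions have equal sizes, so none is properly contained in another. *)
Lemma maximal_allowed_path_arcs k :
  [set A : {set 'I_k.+2 * 'I_k.+2} | maximal_allowed A] =
  [set path_arcs k (val v) | v in [set v : k.-tuple (bool * bool) | valid v]].
Proof.
apply/setP => A; rewrite inE; apply/maxsetP/imsetP.
  case=> allA maxA; have [v [val_v sub_v]] := allowed_sub_path_arcs allA.
  exists v; rewrite ?inE //; apply/esym/maxA => //.
  by apply: allowed_path_arcs => //; exact: size_tuple.
case=> v; rewrite inE => val_v ->.
have allv : allowed (path_arcs k v).
  by apply: allowed_path_arcs => //; exact: size_tuple.
split=> // B allB sub_vB; have [w [val_w sub_Bw]] := allowed_sub_path_arcs allB.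
have eq_vw : path_arcs k v = path_arcs k w.
  apply/eqP; rewrite eqEcard (subset_trans sub_vB sub_Bw) /=.
  by rewrite !card_path_arcs ?size_tuple.
by apply/eqP; rewrite eqEsubset sub_vB eq_vw sub_Bw.
Qed.

Theorem lemmaA1 (n : nat) (hn : 2 <= n) :
  [/\ (forall A : {set 'I_n * 'I_n}, allowed A -> ~~ maximal_allowed A ->
         exists B : {set 'I_n * 'I_n},
           [/\ allowed B, A \subset B & #|B| = 2 * n - 3]),
      ((exists A : {set 'I_n * 'I_n}, allowed A /\ #|A| = 2 * n - 3) /\
       (forall A : {set 'I_n * 'I_n}, allowed A -> #|A| <= 2 * n - 3))
    & #|[set A : {set 'I_n * 'I_n} | maximal_allowed A]| = catalan (n - 2)].
Proof.
case: n hn => [|[|k]] // _.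
have -> : k.+2 - 2 = k by lia.
have -> : 2 * k.+2 - 3 = (2 * k).+1 by lia.
have extend (A : {set 'I_k.+2 * 'I_k.+2}) : allowed A ->
    exists B : {set 'I_k.+2 * 'I_k.+2},
      [/\ allowed B, A \subset B & #|B| = (2 * k).+1].
  case/allowed_sub_path_arcs => v [val_v sub_v]; exists (path_arcs k v).
  by split=> //; [apply: allowed_path_arcs | apply: card_path_arcs];
    rewrite ?size_tuple.
split=> [A allA _||]; first exact: extend.
  split; last by move=> A /extend[B [_ /subset_leq_card + <-]].
  have all0 : allowed (set0 : {set 'I_k.+2 * 'I_k.+2}).
    by apply/allowedP; split=> [c|c c'|c1 c2 c3]; rewrite inE.
  by have [B [allB _ cardB]] := extend _ all0; exists B.
rewrite maximal_allowed_path_arcs card_in_imset ?card_valid // => v w.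
rewrite !inE => val_v val_w /path_arcs_inj eq_vw.
by apply/val_inj/eq_vw; rewrite ?size_tuple.
Qed.
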